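(* Let $G,\Omega,\Sigma=\{\Delta_1,\dots,\Delta_s\},\Delta=\Delta_1,L,M,R,\rho_{i,j},B_A$ be as in the context. Let $X:=G^{(2),\Omega}$ and $Y:=X_\Delta^\Delta$ (the permutation group induced on $\Delta$ by the setwise stabiliser $X_\Delta$). Suppose that $G\ne X$ but $L=L^{(2),\Sigma}$. (a) Then $X=N\rtimes G$ with $N=X\cap B_Y\ne1$, and $N$ is a subdirect subgroup of a base group $B_A=A^s$ for some $A\unlhd Y$. (b) If $M$ is maximal in $G$, then either (i) $N$ is a full diagonal subgroup of $B_A$; or (ii) for all distinct $i,j\le s$, $\rho_{i,j}(N)$ is not a full diagonal subgroup of $A\times A$; moreover, either $N$ contains the base group $B_{\mathcal S(Y)}$, or $Y$ has a unique minimal normal subgroup which is isomorphic to $C_p$, for some prime $p$. (c) Furthermore, if $M$ is maximal but not normal in $G$, and if in addition $p=|R|$ is prime and (b)(i) holds, then $Y=R$ and $N$ is the diagonal subgroup $\{(x,\dots,x): x\in R\}$ of $B_R=R^s\cong C_p^s$.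
   Context: For $P\le\mathrm{Sym}(\Gamma)$, $P^{(2),\Gamma}$ denotes the $2$-closure: all $g\in\mathrm{Sym}(\Gamma)$ leaving invariant each $P$-orbit on $\Gamma\times\Gamma$. If $P$ acts on $\Gamma$, $P^\Gamma$ is the induced permutation group. Setting. $G$ is a finite group acting faithfully, transitively and imprimitively on a finite set $\Omega$; $\Sigma=\{\Delta_1,\dots,\Delta_s\}$ is a nontrivial $G$-invariant partition of $\Omega$, $1<s<|\Omega|$; $L=G^\Sigma\le\mathrm{Sym}(\Sigma)$; $\Delta=\Delta_1$; $M=G_\Delta$ is the setwise stabiliser of $\Delta$; $R=M^\Delta\le\mathrm{Sym}(\Delta)$. It is assumed that $M$ is core-free in $G$ (equivalently $G$ acts faithfully on $\Sigma$, so $G\cong L$). By the imprimitive wreath embedding theorem, identify $\Sigma$ with $\{1,\dots,s\}$, $\Omega$ with $\Delta\times\{1,\dots,s\}$ and $\Delta_i$ with $\Delta\times\{i\}$ so that $G\le R\wr L=B_R\rtimes L$, where $B_R=R^s$, and $(x_1,\dots,x_s)\in B_R$ and $\sigma\in L$ act by $(\delta,i)^{(x_1,\dots,x_s)}=(\delta^{x_i},i)$ and $(\delta,i)^\sigma=(\delta,i^\sigma)$. For any $A\le\mathrm{Sym}(\Delta)$, $B_A=A^s$ denotes the naturally embedded base group in $\mathrm{Sym}(\Delta)\wr\mathrm{Sym}(s)$. On $B_A$, $\rho_{i,j}(x_1,\dots,x_s)=(x_i,x_j)$. A subgroup of a direct product is subdirect if it projects onto each direct factor. A full diagonal subgroup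 of $E^f$ is a subgroup of the form $\{(e,e^{\theta_2},\dots,e^{\theta_f}): e\in E\}$ with all $\theta_i\in\mathrm{Aut}(E)$. For a finite group $Y$, $\mathcal S(Y)$ is the intersection of all nontrivial subnormal subgroups of $Y$. *)

(* Defs.v *)
From HB Require Import structures.
From mathcomp Require Import all_boot all_order all_algebra.
From mathcomp Require Import all_fingroup all_solvable.

Set Implicit Arguments.
Unset Strict Implicit.
Unset Printing Implicit Defensive.

Import GroupScope.

Notation pts S := {x | x \in S}.

(* Permutations act on the right and [p * q] is "first p, then q".           *)

(* P^S, the subgroup of Sym(S) induced by P, for P a subgroup of the setwise
   stabiliser of S.  (The image of a morphism ignores elements outside its
   domain, which for [to^?] is the setwise stabiliser of S.)                 *)
Definition induced (aT : finGroupType) (T : finType) (to : {action aT &-> T})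
    (S : {set T}) (P : {set aT}) : {set {perm pts S}} :=
  actperm (subaction (pts S) to) @* P.

Canonical induced_group (aT : finGroupType) (T : finType)
    (to : {action aT &-> T}) (S : {set T}) (P : {group aT}) :=
  Eval hnf in [group of induced to S P].

(* ['P * 2] is the componentwise action on ordered pairs, so this is the group
   of all permutations leaving invariant each P-orbit on pairs.              *)
Definition closure2 (T : finType) (P : {set {perm T}}) : {set {perm T}} :=
  \bigcap_(t : 2.-tuple T) 'N(orbit ('P * 2) P t | 'P * 2).

Canonical closure2_group (T : finType) (P : {set {perm T}}) :=
  Eval hnf in [group of closure2 P].

(* The intersection of all nontrivial subnormal subgroups.                   *)
Definition subnormal_core (gT : finGroupType) (Y : {set gT}) : {set gT} :=
  \bigcap_(H : {group gT} | (H <|<| Y) && (H :!=: 1)) H.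

Definition minimal_normal (gT : finGroupType) (K Y : {set gT}) : bool :=
  [min K of H | (H :!=: 1) && (H <| Y)].

Section Wreath.

Variables D I : finType.

Definition base_fun (x : {ffun I -> {perm D}}) (u : D * I) : D * I :=
  (x u.2 u.1, u.2).

Lemma base_fun_inj x : injective (base_fun x).
Proof. by case=> [d i] [e j] [] /[swap] <- /perm_inj ->. Qed.

Definition base_perm x : {perm D * I} := perm (@base_fun_inj x).

Definition top_fun (sigma : {perm I}) (u : D * I) : D * I := (u.1, sigma u.2).

Lemma top_fun_inj sigma : injective (top_fun sigma).
Proof. by case=> [d i] [e j] [] -> /perm_inj ->. Qed.

Definition top_perm sigma : {perm D * I} := perm (@top_fun_inj sigma).

Definition base_group (A : {set {perm D}}) : {set {perm D * I}} :=
  [set base_perm x | x : {ffun I -> {perm D}} in ffun_on [in A]].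

Definition wreath (A : {set {perm D}}) (L : {set {perm I}}) :
    {set {perm D * I}} :=
  base_group A * (top_perm @: L).

Section Identification.

(* [phi] is meant to be a bijection, identifying Omega with D * I.           *)
Variables (Omega : finType) (phi : Omega -> D * I).

Definition same_perm (g : {perm Omega}) (w : {perm D * I}) : bool :=
  [forall o, phi (g o) == w (phi o)].

(* W, viewed inside Sym(Omega).                                              *)
Definition transport (W : {set {perm D * I}}) : {set {perm Omega}} :=
  [set g | [exists w in W, same_perm g w]].

(* N, viewed as a set of tuples; meant for N contained in the base group.    *)
Definition tuples (N : {set {perm Omega}}) : {set {ffun I -> {perm D}}} :=
  [set x | [exists g in N, same_perm g (base_perm x)]].

End Identification.

End Wreath.

Section Tuples.

Variables (I : finType) (gT : finGroupType).
Implicit Types (E : {set gT}) (N : {set {ffun I -> gT}}).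

Definition subdirect E N : Prop :=
  N \subset ffun_on [in E] /\
  (forall i, [set x i | x : {ffun I -> gT} in N] = E).

(* The coordinate [i1] plays the role of the first one.                      *)
Definition full_diagonal (i1 : I) E N : Prop :=
  exists theta : I -> {perm gT},
    [/\ forall i, theta i \in Aut E,
        theta i1 = 1
      & N = [set [ffun i => theta i e] | e in E]].

Definition full_diagonal2 E (P : {set gT * gT}) : Prop :=
  exists2 theta : {perm gT}, theta \in Aut E & P = [set (e, theta e) | e in E].

Definition rho (i j : I) (x : {ffun I -> gT}) : gT * gT := (x i, x j).

Definition straight_diagonal E : {set {ffun I -> gT}} :=
  [set [ffun=> e] | e in E].

End Tuples.

Arguments straight_diagonal : clear implicits.

(* Main.v *)
Require Import Defs.
From mathcomp Require Import all_boot all_order all_algebra.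
From mathcomp Require Import all_fingroup all_solvable.
From mathcomp Require Import mxabelem.

(* Since [L] is 2-closed, [X] and [G] induce the same group on [Sigma], so [X]
   is the product of [G] and the kernel [N] of [X] on [Sigma]; the two meet
   trivially because [M] is core-free.  Conjugation by [G] permutes the kernels
   of the coordinate projections of [N], and the normaliser in [G] of the first
   kernel contains [M].  If [M] is maximal, then either all these kernels are
   equal, so that the first coordinate determines the others, or they are
   pairwise distinct.  In the latter case, when [S(Y)] is nontrivial it is
   simple and is the unique minimal normal subgroup of [Y]; if it is nonabelian,
   commutators of elements of different kernels show that [N] contains
   [S(Y)^s].  For (c), [R] is abelian and transitive, hence regular and
   2-closed, whence [Y = R = A]; then [M] centralises the diagonal group [N], so
   the normal subgroup ['C_G(N)] is all of [G] and the diagonal is straight. *)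

Set Implicit Arguments.
Unset Strict Implicit.
Unset Printing Implicit Defensive.

Import GroupScope.

(** * The 2-closure of a permutation group *)

Section Closure2.

Variable T : finType.

(** Turns invariance of orbits on 2-tuples into agreement on pairs of points, the form in which the
    2-closure enters every later argument. *)
Lemma closure2P (P : {group {perm T}}) (x : {perm T}) :
  reflect (forall a b, exists2 g, g \in P & g a = x a /\ g b = x b)
          (x \in closure2 P).
Proof.
apply: (iffP bigcapP) => [Xx a b | Px t _].
  have:= astabs_act [tuple a; b] (Xx [tuple a; b] isT).
  rewrite orbit_refl => /orbitP[g Pg] /(congr1 val) [ga gb].
  by exists g => //; split.
rewrite !inE; apply/subsetP=> u /orbitP[h Ph <-]; rewrite inE.
set v := ('P * 2)%act t h; rewrite -/v.
have [g Pg [ga gb]] := Px (tnth v ord0) (tnth v ord_max).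
suff ->: ('P * 2)%act v x = ('P * 2)%act v g.
  by rewrite /v -actMin ?inE //; apply: mem_orbit; rewrite groupM.
apply: eq_from_tnth => i; move: v ga gb => v ga gb; rewrite !tnth_map.
by case: i => [[|[|]]] //= lt_i2; apply: esym;
  [rewrite (_ : Ordinal lt_i2 = ord0) | rewrite (_ : Ordinal lt_i2 = ord_max)];
  rewrite //; apply: val_inj.
Qed.

Lemma sub_closure2 (P : {group {perm T}}) : P \subset closure2 P.
Proof. by apply/subsetP=> g Pg; apply/closure2P => a b; exists g. Qed.

(** Elements of [P] that agree at one point [a] agree everywhere, since they commute with the
    elements moving [a] to any [b]. So the [g] matching [x] at [a] matches it at every [b]. *)
Lemma closure2_abelian_transitive (P : {group {perm T}}) :
  abelian P -> [transitive P, on [set: T] | 'P] -> closure2 P = P.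
Proof.
move=> cPP trP; apply/eqP; rewrite eqEsubset sub_closure2 andbT.
apply/subsetP=> x /closure2P Xx.
have [a _ | T0] := pickP (@predT T); last first.
  by rewrite (_ : x = 1) //; apply/permP=> a; have:= T0 a.
have [g Pg [ga _]] := Xx a a.
rewrite (_ : x = g) //; apply/permP=> b.
have [h Ph [ha <-]] := Xx a b.
have [k Pk ->] := atransP2 trP (in_setT a) (in_setT b).
rewrite /= /aperm -!permM.
by rewrite (centsP cPP _ Pk _ Ph) (centsP cPP _ Pk _ Pg) !permM ha ga.
Qed.

End Closure2.

(** * Groups induced on a subset *)

Section Induced.

Variables (aT : finGroupType) (T : finType) (to : {action aT &-> T}).
Variable S : {set T}.

Let subact_domE : subact_dom (fun x => x \in S) to = 'N(S | to).
Proof. by rewrite /subact_dom; congr 'N(_ | _); apply/setP=> x; rewrite inE. Qed.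

Lemma val_actperm_sub a (u : pts S) : a \in 'N(S | to) ->
  val (actperm (subaction (pts S) to) a u) = to (val u) a.
Proof. by move=> nSa; rewrite actpermE val_subact subact_domE nSa. Qed.

Lemma inducedP (P : {set aT}) (y : {perm pts S}) :
  reflect (exists a, [/\ a \in P, a \in 'N(S | to)
                       & forall u, val (y u) = to (val u) a])
          (y \in induced to S P).
Proof.
apply: (iffP morphimP) => [[a nSa Pa ->] | [a [Pa nSa ya]]].
  rewrite /= subact_domE in nSa.
  by exists a; split=> // u; apply: val_actperm_sub.
exists a => //; first by rewrite /= subact_domE.
by apply/permP=> u; apply: val_inj; rewrite ya val_actperm_sub.
Qed.

Lemma inducedS (P Q : {set aT}) :
  P \subset Q -> induced to S P \subset induced to S Q.
Proof. exact: morphimS. Qed.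

End Induced.

(** * The intersection of the nontrivial subnormal subgroups *)

Section SubnormalCore.

Variables (gT : finGroupType) (Y : {group gT}).
Hypothesis ntY : Y :!=: 1.

Canonical subnormal_core_group := Eval hnf in [group of subnormal_core Y].

Lemma subnormal_core_min (H : {group gT}) :
  H <|<| Y -> H :!=: 1 -> subnormal_core Y \subset H.
Proof. by move=> snHY ntH; apply: bigcap_inf; rewrite snHY. Qed.

(** Conjugation by an element of [Y] permutes the nontrivial subnormal subgroups of [Y]. *)
Lemma subnormal_core_normal : subnormal_core Y <| Y.
Proof.
rewrite /normal subnormal_core_min ?subnormal_refl //=.
apply/subsetP=> y Yy; rewrite inE.
apply/bigcapsP=> H /andP[snHY ntH]; rewrite sub_conjg.
apply: subnormal_core_min; last first.
  by rewrite -(inj_eq (@conjsg_inj _ y)) conjsgKV conjs1g.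
have := morphim_subnormal (conjgm_morphism Y y^-1) snHY.
rewrite !morphim_conj setIid (setIidPr (subnormal_sub snHY)).
by rewrite (conjGid (groupVr Yy)).
Qed.

(** A normal subgroup of the core is subnormal in [Y], so if nontrivial it contains the core. *)
Lemma subnormal_core_simple :
  subnormal_core Y :!=: 1 -> simple (subnormal_core Y).
Proof.
move=> ntT; apply/simpleP; split=> // H nsHT.
have [-> | ntH] := eqVneq (H : {set gT}) 1; [by left | right].
apply/eqP; rewrite eqEsubset normal_sub //=.
apply: subnormal_core_min => //.
apply: subnormal_trans (normal_subnormal nsHT) _.
exact: normal_subnormal subnormal_core_normal.
Qed.

Lemma minimal_normal_subnormal_core :
  subnormal_core Y :!=: 1 -> minimal_normal (subnormal_core Y) Y.
Proof.
move=> ntT; apply/mingroupP; rewrite ntT subnormal_core_normal; split=> // H.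
case/andP=> ntH nsHY sHT; apply/eqP; rewrite eqEsubset sHT.
exact: subnormal_core_min (normal_subnormal nsHY) ntH.
Qed.

Lemma minimal_normal_eq_subnormal_core (H : {group gT}) :
  subnormal_core Y :!=: 1 -> minimal_normal H Y -> H :=: subnormal_core Y.
Proof.
move=> ntT /mingroupP[/andP[ntH nsHY] minH].
apply/esym/(minH subnormal_core_group); first by rewrite ntT subnormal_core_normal.
exact: subnormal_core_min (normal_subnormal nsHY) ntH.
Qed.

End SubnormalCore.

(** * Coordinates of permutations that fix every block *)

Section Coordinates.

Variables (D I Omega : finType) (phi : Omega -> D * I).
Hypothesis phi_bij : bijective phi.

(** The full base group of Sym(D) wr Sym(I) seen inside Sym(Omega), described without tuples. *)
Definition vertical : {set {perm Omega}} :=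
  [set g : {perm Omega} | [forall o, (phi (g o)).2 == (phi o).2]].

Lemma verticalP (g : {perm Omega}) :
  reflect (forall o, (phi (g o)).2 = (phi o).2) (g \in vertical).
Proof. by rewrite inE; apply: 'forall_eqP. Qed.

Fact vertical_group_set : group_set vertical.
Proof.
apply/group_setP; split=> [|g h /verticalP Vg /verticalP Vh].
  by apply/verticalP=> o; rewrite perm1.
by apply/verticalP=> o; rewrite permM Vh.
Qed.

Canonical vertical_group := group vertical_group_set.

(* The permutation of [D] that [g] induces on the block over [i]; a junk value
   outside [vertical].                                                        *)
Definition fiber (i : I) (g : {perm Omega}) : {perm D} :=
  odflt 1 [pick r : {perm D} |
    [forall o, ((phi o).2 == i) ==> (phi (g o) == (r (phi o).1, i))]].

Lemma fiberE g o : g \in vertical ->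
  phi (g o) = (fiber (phi o).2 g (phi o).1, (phi o).2).
Proof.
move/verticalP=> Vg; rewrite /fiber.
case: pickP => [r /forallP/(_ o) | /=]; first by rewrite eqxx => /eqP.
case: phi_bij => psi phiK psiK; set i := (phi o).2 => nor.
(* The witness is [g] read through [phi] on the fibre over [i]; an injective self-map of [D] is a
   permutation. *)
have r_inj : injective (fun d => (phi (g (psi (d, i)))).1).
  move=> d e eq_de; suff: psi (d, i) = psi (e, i) by move/(can_inj psiK)=> [].
  apply: (@perm_inj _ g); apply: (can_inj phiK); move: eq_de.
  have:= Vg (psi (d, i)); have:= Vg (psi (e, i)); rewrite !psiK /=.
  by do 2!case: (phi _) => ? ? /=; move=> -> -> ->.
have/negP[] := nor (perm r_inj).
apply/forallP=> o'; apply/implyP=> /eqP o'_i; rewrite permE.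
have ->: ((phi o').1, i) = phi o' by rewrite -o'_i -surjective_pairing.
rewrite phiK; have:= Vg o'; rewrite o'_i -/i => <-.
by rewrite -surjective_pairing.
Qed.

Lemma fiber_uniq g i (r : {perm D}) : g \in vertical ->
  (forall o, (phi o).2 = i -> (phi (g o)).1 = r (phi o).1) -> fiber i g = r.
Proof.
case: phi_bij => psi phiK psiK Vg rP; apply/permP=> d.
by have:= rP (psi (d, i)); rewrite fiberE // psiK; apply.
Qed.

Fact fiberM i : {in vertical &, {morph fiber i : g h / g * h}}.
Proof.
move=> g h Vg Vh; apply: fiber_uniq => [|o o_i]; first exact: groupM.
by rewrite permM fiberE // fiberE // o_i permM.
Qed.

Canonical fiber_morphism i := Morphism (fiberM i).

Lemma fiber_inj g h : g \in vertical -> h \in vertical ->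
  (forall i, fiber i g = fiber i h) -> g = h.
Proof.
move=> Vg Vh eq_gh; apply/permP=> o; apply: (bij_inj phi_bij).
by rewrite !fiberE ?eq_gh.
Qed.

Lemma fiber_eq1 g : g \in vertical -> (forall i, fiber i g = 1) -> g = 1.
Proof.
by move=> Vg g1; apply: fiber_inj => // i; rewrite g1 (morph1 (fiber_morphism i)).
Qed.

Lemma same_base_perm g (x : {ffun I -> {perm D}}) :
  same_perm phi g (base_perm x) =
  (g \in vertical) && (x == [ffun i => fiber i g]).
Proof.
apply/forallP/andP=> [gx | [Vg /eqP->] o]; last first.
  by rewrite fiberE // permE /base_fun ffunE.
have Vg : g \in vertical.
  by apply/verticalP=> o; rewrite (eqP (gx o)) permE.
split=> //; apply/eqP/ffunP=> i; rewrite ffunE; apply/esym/fiber_uniq => // o <-.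
by rewrite (eqP (gx o)) permE.
Qed.

Lemma mem_transport_base A g :
  (g \in transport phi (base_group I A)) =
  (g \in vertical) && [forall i, fiber i g \in A].
Proof.
rewrite inE; apply/exists_inP/andP=> [[_ /imsetP[x Ax ->]] | [Vg /forallP Ag]].
  rewrite same_base_perm => /andP[Vg /eqP def_x]; split=> //.
  by apply/forallP=> i; have/ffun_onP/(_ i) := Ax; rewrite def_x ffunE.
exists (base_perm [ffun i => fiber i g]); last by rewrite same_base_perm Vg eqxx.
by apply/imset_f/ffun_onP=> i; rewrite ffunE.
Qed.

Lemma tuplesE (N : {set {perm Omega}}) : N \subset vertical ->
  tuples phi N = [set [ffun i => fiber i g] | g in N].
Proof.
move/subsetP=> sNV; apply/setP=> x; rewrite inE.
apply/exists_inP/imsetP=> [[g Ng] | [g Ng ->]].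
  by rewrite same_base_perm => /andP[_ /eqP->]; exists g.
by exists g; rewrite // same_base_perm sNV ?eqxx.
Qed.

Lemma vertical_lift (x : {ffun I -> {perm D}}) :
  exists2 g, g \in vertical & forall i, fiber i g = x i.
Proof.
case: phi_bij => psi phiK psiK.
have g_inj : injective (fun o => psi (base_perm x (phi o))).
  by move=> o o' /(can_inj psiK)/perm_inj/(can_inj phiK).
have Vg : perm g_inj \in vertical.
  by apply/verticalP=> o; rewrite permE psiK permE.
exists (perm g_inj) => // i; apply: fiber_uniq => // o <-.
by rewrite permE psiK permE.
Qed.

(** [g] acts through [phi] as the wreath product element with base part [x] and top part [s]; [x] is
    indexed by the block before the move. *)
Definition twisted (g : {perm Omega}) (x : I -> {perm D}) (s : {perm I}) :=
  forall o, phi (g o) = (x (phi o).2 (phi o).1, s (phi o).2).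

(** At a point of the form [g o], [k ^ g] acts as [g] applied to [k o]. This carries information
    from coordinate [i] to coordinate [s i]. *)
Lemma fiber_conj g x s k i : twisted g x s -> k \in vertical ->
  k ^ g \in vertical /\ fiber (s i) (k ^ g) = fiber i k ^ x i.
Proof.
move=> gxs Vk.
have Vkg : k ^ g \in vertical.
  apply/verticalP=> o; rewrite -[o](permKV g) permJ !gxs /=.
  by rewrite (verticalP _ Vk).
split=> //; apply: fiber_uniq => // o; rewrite -[o](permKV g) permJ !gxs /=.
by move/perm_inj=> o_i; rewrite fiberE //= o_i permJ.
Qed.

Lemma twisted_divg g x s h y t : twisted g x s -> twisted h y t ->
  twisted (g * h^-1) (fun i => x i * (y ((s * t^-1) i))^-1) (s * t^-1).
Proof.
move=> gxs hyt o; have:= hyt ((g * h^-1) o); rewrite permM permKV gxs.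
rewrite [phi (h^-1 _)]surjective_pairing => -[e1 e2]; congr (_, _).
  by rewrite !permM e2 permK e1 permK.
by rewrite permM e2 permK.
Qed.

(** * Order and structure of the base group *)

Section BaseGroupOrder.

Variable A : {group {perm D}}.

Fact transport_base_group_set : group_set (transport phi (base_group I A)).
Proof.
apply/group_setP; split=> [|g h].
  by rewrite mem_transport_base group1; apply/forallP=> i; rewrite morph1.
rewrite !mem_transport_base => /andP[Vg /forallP Ag] /andP[Vh /forallP Ah].
by rewrite groupM //; apply/forallP=> i; rewrite fiberM ?groupM.
Qed.

Canonical transport_base_group := group transport_base_group_set.

(** Reading off all coordinates is a bijection onto the functions from [I] to [A]. *)
Lemma card_transport_base : #|transport phi (base_group I A)| = (#|A| ^ #|I|)%N.
Proof.
pose f g := [ffun i => fiber i g] : {ffun I -> {perm D}}.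
have f_inj : {in transport phi (base_group I A) &, injective f}.
  move=> g h; rewrite !mem_transport_base => /andP[Vg _] /andP[Vh _] eq_f.
  by apply: fiber_inj => // i; move/ffunP/(_ i): eq_f; rewrite !ffunE.
rewrite -(card_in_imset f_inj) -card_ffun_on.
apply: eq_card => x; apply/imsetP/ffun_onP=> [[g Bg ->] i | Ax].
  by rewrite ffunE; move: Bg; rewrite mem_transport_base => /andP[_ /forallP].
have [g Vg gx] := vertical_lift x.
exists g; last by apply/ffunP=> i; rewrite ffunE.
by rewrite mem_transport_base Vg; apply/forallP=> i; rewrite gx; apply: Ax.
Qed.

Lemma abelem_transport_base p : prime p ->
  p.-abelem A -> p.-abelem (transport phi (base_group I A)).
Proof.
move=> p_pr /(abelemP p_pr)[cAA Ap]; apply/(abelemP p_pr); split=> [|g].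
  apply/centsP=> g; rewrite mem_transport_base => /andP[Vg /forallP Ag] h.
  rewrite mem_transport_base => /andP[Vh /forallP Ah].
  apply: fiber_inj => [||i]; rewrite ?groupM // !fiberM //.
  exact: (centsP cAA).
rewrite mem_transport_base => /andP[Vg /forallP Ag].
apply: fiber_inj => [||i]; rewrite ?groupX ?group1 //.
by rewrite morphX // morph1; apply: Ap (Ag i).
Qed.

End BaseGroupOrder.

(** * Base subgroups normalised by a transitive group, and their coordinate kernels *)

Section NormalisedBase.

Variables (G N : {group {perm Omega}}) (R : {set {perm D}}) (i0 : I).
Variable A : {group {perm D}}.
Hypotheses (sNV : N \subset vertical) (nNG : G \subset 'N(N)).
Hypothesis twistedG : forall g, g \in G ->
  exists2 x, forall i, x i \in R & exists s, twisted g x s.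
Hypothesis transG : forall i, exists2 g, g \in G &
  exists2 x, forall j, x j \in R & exists2 s, twisted g x s & s i0 = i.
Hypotheses (nAR : R \subset 'N(A)) (fiberN0 : fiber i0 @* N = A).

(** An element of [G] taking coordinate [i0] to [i] normalises [N], and its base part normalises
    [A]. *)
Lemma fiber_normalised i : fiber i @* N = A.
Proof.
have [g Gg [x Rx [s gxs <-]]] := transG i.
rewrite -(normsP nAR _ (Rx i0)) -fiberN0 !morphimEsub //.
rewrite -{1}(normsP nNG _ Gg) /conjugate -!imset_comp.
apply: eq_in_imset => n Nn /=.
by have [_ ->] := fiber_conj i0 gxs (subsetP sNV n Nn).
Qed.

Lemma subdirect_normalised : subdirect A (tuples phi N).
Proof.
rewrite tuplesE //; split=> [|i].
  apply/subsetP=> _ /imsetP[n Nn ->]; apply/ffun_onP=> i.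
  by rewrite ffunE -(fiber_normalised i) mem_morphim ?(subsetP sNV).
rewrite -(fiber_normalised i) morphimEsub // -imset_comp.
by apply: eq_imset => n; rewrite /= ffunE.
Qed.

Lemma normalised_eq1 : A :=: 1 -> N :=: 1.
Proof.
move=> A1; apply/trivgP/subsetP=> n Nn; have Vn := subsetP sNV n Nn.
rewrite inE; apply/eqP/fiber_eq1 => // i; apply/set1P.
by rewrite -[[set 1]]A1 -(fiber_normalised i) mem_morphim.
Qed.

Lemma mem_ker_fiber i n :
  (n \in 'ker_N (fiber i)) = (n \in N) && (fiber i n == 1).
Proof.
rewrite inE; apply: andb_id2l => Nn.
exact: (sameP (kerP _ (subsetP sNV n Nn)) eqP).
Qed.

Lemma ker_fiber_normal i : 'ker_N (fiber i) <| N.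
Proof. exact: normalGI sNV (ker_normal _). Qed.

(** All coordinate kernels thus have the same order, so an inclusion between two of them is an
    equality. *)
Lemma card_ker_fiber i : (#|'ker_N (fiber i)| * #|A|)%N = #|N|.
Proof.
rewrite -(fiber_normalised i) card_morphim (setIidPr sNV) -indexgI.
by rewrite Lagrange ?subsetIl.
Qed.

Lemma ker_fiber_conj g x s i : g \in G -> twisted g x s ->
  'ker_N (fiber i) :^ g = 'ker_N (fiber (s i)).
Proof.
move=> Gg gxs; apply/setP=> n; rewrite -[n](conjgKV g); move: (n ^ _) => {}n.
rewrite memJ_conjg !mem_ker_fiber memJ_norm ?(subsetP nNG) //.
apply: andb_id2l => Nn.
have [_ ->] := fiber_conj i gxs (subsetP sNV _ Nn).
by rewrite conjg_eq1.
Qed.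

(** The normaliser in [G] of the kernel at [i0] contains [M], so it is [G] or [M]. In the first case
    transitivity makes all kernels equal. *)
Lemma ker_fiber_dichotomy (M : {group {perm Omega}}) : maximal M G ->
    (forall g x s, g \in G -> twisted g x s -> (g \in M) = (s i0 == i0)) ->
  (forall i, 'ker_N (fiber i) = 'ker_N (fiber i0)) \/
  (forall i j, i != j -> 'ker_N (fiber i) != 'ker_N (fiber j)).
Proof.
case/maxgroupP=> /andP[sMG _] maxM memM.
have sMn : M \subset 'N_G('ker_N (fiber i0)).
  apply/subsetP=> g Mg; have Gg := subsetP sMG g Mg.
  have [x _ [s gxs]] := twistedG Gg; rewrite inE Gg; apply/normP.
  rewrite (ker_fiber_conj i0 Gg gxs).
  by have/eqP-> : s i0 == i0 by rewrite -(memM g x s).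
have [nG | ltG] := eqVneq 'N_G('ker_N (fiber i0)) G.
  left=> i; have [g Gg [x _ [s gxs <-]]] := transG i.
  rewrite -(ker_fiber_conj _ Gg gxs); apply/normP.
  by rewrite -{}nG inE in Gg; case/andP: Gg.
have {ltG}nM : 'N_G('ker_N (fiber i0)) = M.
  by apply: (maxM 'N_G('ker_N (fiber i0))%G); rewrite //= properEneq ltG subsetIl.
right=> i j; apply: contra => /eqP eq_ij.
have [g Gg [x _ [s gxs si]]] := transG i; have [h Gh [y _ [t hyt tj]]] := transG j.
(* Equal kernels at [i] and [j] make [g * h^-1] normalise the kernel at [i0], hence lie in [M] and
   fix [i0]; so [i = j]. *)
have Mgh : g * h^-1 \in M.
  rewrite -nM inE groupM ?groupV //=; apply/normP.
  rewrite conjsgM (ker_fiber_conj _ Gg gxs) si eq_ij -tj.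
  by rewrite -(ker_fiber_conj _ Gh hyt) conjsgK.
have ghst := twisted_divg gxs hyt.
move: (Mgh); rewrite (memM _ _ _ (subsetP sMG _ Mgh) ghst) permM si.
by rewrite -(inj_eq (@perm_inj _ t)) permKV tj.
Qed.

(** With equal kernels, coordinate [i0] of an element of [N] determines its coordinate [i]; the
    resulting maps on [A] are the required automorphisms. *)
Lemma full_diagonal_ker_fiber :
  (forall i, 'ker_N (fiber i) = 'ker_N (fiber i0)) ->
  full_diagonal i0 A (tuples phi N).
Proof.
move=> eq_ker.
(* Coordinate [i] of some lift of [a] to [N]; the default 1 is reached only when [a] is outside
   [A]. *)
pose f i a := fiber i (odflt 1 [pick n in N | fiber i0 n == a]).
have kerN i n : n \in N -> (fiber i n == 1) = (fiber i0 n == 1).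
  by move=> Nn; have/setP/(_ n) := eq_ker i; rewrite !mem_ker_fiber Nn.
have fE i n : n \in N -> f i (fiber i0 n) = fiber i n.
  move=> Nn; rewrite /f; case: pickP => [m /andP[Nm] | /(_ n)] /=; last first.
    by rewrite Nn eqxx.
  have [Vm Vn] := (subsetP sNV m Nm, subsetP sNV n Nn).
  rewrite eq_mulgV1 -morphV // -morphM ?groupV //= -(kerN i) ?groupM ?groupV //.
  by rewrite fiberM ?groupV // (morphV (fiber_morphism i)) // -eq_mulgV1 => /eqP.
have liftA a : a \in A -> exists2 n, n \in N & a = fiber i0 n.
  by rewrite -fiberN0 => /morphimP[n _ Nn ->]; exists n.
have fM i : {in A &, {morph f i : a b / a * b}}.
  move=> _ _ /liftA[m Nm ->] /liftA[n Nn ->].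
  by rewrite -fiberM ?(subsetP sNV) // !fE ?groupM // fiberM ?(subsetP sNV).
pose fm i := Morphism (fM i).
have injf i : 'injm (fm i).
  apply/subsetP=> a /morphpreP[/liftA[n Nn ->]] /set1P /=.
  by rewrite fE // => /eqP; rewrite kerN // => /eqP->; rewrite inE.
have defA : fiber i0 @: N = A by rewrite -fiberN0 morphimEsub.
have imf i : fm i @* A = A.
  rewrite morphimEdom -[RHS](fiber_normalised i) morphimEsub //.
  transitivity (f i @: (fiber i0 @: N)); first by rewrite defA.
  by rewrite -imset_comp; apply: eq_in_imset => n Nn /=; rewrite fE.
exists (fun i => aut (injf i) (imf i)); split=> [i||].
- exact: Aut_aut.
- apply: (@eq_Aut _ A); rewrite ?Aut_aut ?group1 // => a Aa.
  by rewrite autE // perm1; case/liftA: Aa => n Nn ->; rewrite /= fE.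
rewrite tuplesE // -[in RHS]defA -imset_comp.
apply: eq_in_imset => n Nn; apply/ffunP=> i; rewrite !ffunE /=.
by rewrite autE /= ?fE // -fiberN0 mem_morphim ?(subsetP sNV).
Qed.

(** [theta] is injective and fixes 1, so coordinates [i] and [j] of an element of [N] are trivial
    together. *)
Lemma ker_fiber_full_diagonal2 i j :
  full_diagonal2 A (rho i j @: tuples phi N) ->
  'ker_N (fiber i) = 'ker_N (fiber j).
Proof.
case=> theta Atheta defP; have th1 : theta 1 = 1.
  by rewrite -(autmE Atheta) morph1.
apply/setP=> n; rewrite !mem_ker_fiber; apply: andb_id2l => Nn.
have: rho i j [ffun k => fiber k n] \in rho i j @: tuples phi N.
  by apply: imset_f; rewrite tuplesE //; apply: imset_f.
rewrite defP /rho !ffunE => /imsetP[e _ [-> ->]].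
by rewrite -{2}th1 (inj_eq perm_inj).
Qed.

(* If [N] has pairwise distinct coordinate kernels, then each kernel projects
   onto a nontrivial normal subgroup of [A] in every other coordinate, so onto
   a subgroup containing [T]; commutators of elements of the kernels then
   isolate a single coordinate, and nothing is lost because [T] is perfect. *)
Lemma transport_base_sub_perfect (T : {group {perm D}}) :
    [~: T, T] = T -> T \subset A ->
    (forall H : {group {perm D}}, H <| A -> H :!=: 1 -> T \subset H) ->
    (forall i j, i != j -> 'ker_N (fiber i) != 'ker_N (fiber j)) ->
  transport phi (base_group I T) \subset N.
Proof.
move=> perfT sTA minT neq_ker.
have sTker i j : i != j -> T \subset fiber j @* 'ker_N (fiber i).
  move=> neq_ij; apply: (minT (fiber j @* 'ker_N (fiber i))%G).
    by rewrite -(fiber_normalised j) morphim_normal // ker_fiber_normal.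
  (* A trivial image would put the kernel at [i] inside the kernel at [j], and equal orders would
     make them equal. *)
  apply: contra (neq_ker i j neq_ij) => /= /eqP im1.
  rewrite eqEcard -(leq_pmul2r (cardG_gt0 A)) !card_ker_fiber leqnn andbT.
  apply/subsetP=> n kn; have:= kn; rewrite !mem_ker_fiber => /andP[Nn _].
  have:= mem_morphim (fiber_morphism j) (subsetP sNV n Nn) kn.
  by rewrite /= im1 => /set1P->; rewrite Nn eqxx.
(* Induction on the list [r] of coordinates to be killed, while [Z] still covers [T] at [j]. *)
have isolate j (r : seq I) : j \notin r -> exists Z : {group {perm Omega}},
    [/\ Z <| N, T \subset fiber j @* Z
      & forall i n, i \in r -> n \in Z -> fiber i n = 1].
  elim: r => [_ | i r IHr]; first by exists N; rewrite fiber_normalised.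
  rewrite inE negb_or => /andP[neq_ji /IHr[Z [nsZN sTZ Z1]]].
  have [[sZN nZN] [sKN nKN]] := (andP nsZN, andP (ker_fiber_normal i)).
  (* The commutator lies in both normal subgroups, so it is trivial on [r] and at [i]; at [j] it
     still covers [[~: T, T]], which is [T]. *)
  exists [~: Z, 'ker_N (fiber i)]%G.
  have sZ'Z : [~: Z, 'ker_N (fiber i)] \subset Z.
    by rewrite commg_subl (subset_trans sKN).
  split=> [||k n].
  - by rewrite /normal (subset_trans sZ'Z) // normsR.
  - rewrite morphimR ?(subset_trans _ sNV) // -{1}perfT commgSS // sTker //.
    by rewrite eq_sym.
  rewrite inE => /predU1P[-> | r_k] Z'n; last first.
    by apply: Z1 => //; apply: (subsetP sZ'Z).
  have: n \in 'ker_N (fiber i).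
    by apply: (subsetP _ _ Z'n); rewrite commg_subr (subset_trans sZN).
  by rewrite mem_ker_fiber => /andP[_ /eqP].
apply/subsetP=> g; rewrite mem_transport_base => /andP[Vg /forallP Tg].
have /fin_all_exists[n nP] j : exists n,
    [/\ n \in N, fiber j n = fiber j g & forall i, i != j -> fiber i n = 1].
  have [|Z [/normal_sub/subsetP sZN /subsetP/(_ _ (Tg j)) sTZ Z1]] :=
    isolate j [seq i <- enum I | i != j]; first by rewrite mem_filter eqxx.
  have /morphimP[n _ Zn ->] := sTZ; exists n; split=> // [|i neq_ij].
    exact: sZN.
  by apply: Z1 => //; rewrite mem_filter neq_ij mem_enum.
have Nn j : n j \in N by have [] := nP j.
suff ->: g = \prod_j n j by apply: group_prod.
apply: fiber_inj => [||i] //.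
  by apply: group_prod => j _; apply: (subsetP sNV).
have ->: fiber i (\prod_j n j) = \prod_j fiber i (n j).
  by apply: (morph_prod (fiber_morphism i)) => j _; apply: (subsetP sNV).
rewrite (big_only1 i) // => [|j neq_ji _]; first by have [_ ->] := nP i.
by have [_ _ ->] := nP j; rewrite // eq_sym.
Qed.

(* [M] centralises [N], since its elements act on the first coordinate as
   elements of the abelian group [A] and that coordinate determines all. *)
Lemma straight_diagonal_normalised (M : {group {perm Omega}}) :
    maximal M G -> ~~ (M <| G) ->
    (forall g x s, g \in G -> twisted g x s -> (g \in M) = (s i0 == i0)) ->
    abelian A -> R \subset A -> full_diagonal i0 A (tuples phi N) ->
  tuples phi N = straight_diagonal I _ A.
Proof.
case/maxgroupP=> /andP[sMG _] maxM not_nsMG memM cAA sRA [theta [_ _ defN]].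
have conjA i n r : n \in N -> r \in R -> fiber i n ^ r = fiber i n.
  move=> Nn Rr; apply/conjg_fixP/commgP; apply: (centsP cAA).
    by rewrite -(fiber_normalised i) mem_morphim ?(subsetP sNV).
  exact: (subsetP sRA).
(* In the diagonal form, coordinate [i0] determines the parameter [e], hence the whole element. *)
have diagN m n : m \in N -> n \in N -> fiber i0 m = fiber i0 n -> m = n.
  have tup k : k \in N -> exists2 e, e \in A & forall i, fiber i k = theta i e.
    move=> Nk; have: [ffun i => fiber i k] \in tuples phi N.
      by rewrite tuplesE //; apply: imset_f.
    rewrite defN => /imsetP[e Ae /ffunP ek]; exists e => // i.
    by have:= ek i; rewrite !ffunE.
  move=> Nm Nn; have [a _ am] := tup m Nm; have [b _ bn] := tup n Nn.
  rewrite am bn => /perm_inj eq_ab.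
  by apply: fiber_inj => [||i]; rewrite ?(subsetP sNV) // am bn eq_ab.
have sMC : M \subset 'C_G(N).
  apply/subsetP=> g Mg; have Gg := subsetP sMG g Mg.
  have [x Rx [s gxs]] := twistedG Gg; rewrite inE Gg; apply/centP=> n Nn.
  apply/commute_sym/commgP/conjg_fixP/diagN; rewrite ?memJ_norm ?(subsetP nNG) //.
  have/eqP s0 : s i0 == i0 by rewrite -(memM g x s).
  have [_] := fiber_conj i0 gxs (subsetP sNV n Nn).
  by rewrite s0 conjA.
have nsCG : 'C_G(N) <| G by rewrite /normal subsetIl normsI ?normG ?norms_cent.
(* A proper ['C_G(N)] would equal [M] by maximality, and [M] would be normal. *)
have cNG : 'C_G(N) = G.
  apply: contraNeq not_nsMG => neqCG.
  rewrite -(maxM 'C_G(N)%G) //= properEneq neqCG; exact: subsetIl.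
(* A [g] carrying [i0] to [i] centralises [N], and its base part acts trivially on the abelian [A],
   so both coordinates agree. *)
have fiber0 i n : n \in N -> fiber i n = fiber i0 n.
  move=> Nn; have [g Gg [x Rx [s gxs <-]]] := transG i.
  have [_] := fiber_conj i0 gxs (subsetP sNV n Nn); rewrite conjA // => <-.
  congr (fiber _ _); apply/esym/conjg_fixP/commgP/commute_sym.
  by move: Gg; rewrite -cNG inE => /andP[_ /centP]; apply.
rewrite tuplesE // /straight_diagonal -fiberN0 morphimEsub // -imset_comp.
by apply: eq_in_imset => n Nn; apply/ffunP=> i; rewrite !ffunE /= fiber0.
Qed.

End NormalisedBase.

End Coordinates.

(** * The kernel of the 2-closure on the blocks *)

Theorem proposition3p8 (Omega : finType) (G : {group {perm Omega}})
    (Sigma : {set {set Omega}}) (Delta1 : pts Sigma)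
    (phi : Omega -> pts (val Delta1) * pts Sigma) :
  let Delta := val Delta1 in
  let L := induced 'P^* Sigma G in
  let M := 'N_G(Delta | 'P) in
  let R := induced 'P Delta M in
  (* the setting *)
  [transitive G, on [set: Omega] | 'P] ->
  partition Sigma [set: Omega] ->
  [acts G, on Sigma | 'P^*] ->
  1 < #|Sigma| < #|Omega| ->
  gcore M G = 1 ->
  (* phi identifies Omega with Delta * Sigma, so that G <= R wr L *)
  bijective phi ->
  (forall o, o \in val (phi o).2) ->
  (forall d : pts Delta, (phi (val d)).1 = d) ->
  G \subset transport phi (wreath R L) ->
  let X := closure2 G in
  let Y := induced 'P Delta 'N_X(Delta | 'P) in
  let N := X :&: transport phi (base_group _ Y) in
  G :!=: X ->
  L = closure2 L ->
  (* (a) *)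
  N ><| G = X /\ N :!=: 1 /\
  exists A : {group {perm pts Delta}},
    [/\ A <| Y /\ subdirect A (tuples phi N),
  (* (b) *)
        maximal M G ->
          full_diagonal Delta1 A (tuples phi N)
          \/ (forall i j : pts Sigma, i != j ->
                ~ full_diagonal2 A (rho i j @: tuples phi N))
             /\ (transport phi (base_group _ (subnormal_core Y)) \subset N
                 \/ exists K : {group {perm pts Delta}},
                      [/\ minimal_normal K Y,
                          forall H : {group {perm pts Delta}},
                            minimal_normal H Y -> H :=: K
                        & exists2 p, prime p & K \isog Zp p])
  (* (c) *)
      & forall p, maximal M G -> ~~ (M <| G) -> prime p -> #|R| = p ->
          full_diagonal Delta1 A (tuples phi N) ->
          [/\ Y = R,
              tuples phi N = straight_diagonal (pts Sigma) _ R
            & transport phi (base_group _ R)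
                \isog [set: 'rV['F_p]_#|Sigma|]]].
Proof.
move=> Delta L M R trG partS actsG /andP[_ _] coreM phi_bij phi_blk phi_fst sGW.
move=> X Y N neqGX closedL.
have [_ trivS _] := and3P partS.
have phi2 o (i : pts Sigma) : (o \in val i) = ((phi o).2 == i).
  apply/idP/eqP=> [io | <- //]; apply: val_inj.
  rewrite -(def_pblock trivS (valP i) io).
  by rewrite -(def_pblock trivS (valP (phi o).2) (phi_blk o)).
have phi2_onto i : exists o, (phi o).2 = i.
  have [i0 | [o io]] := set_0Vmem (val i); last by exists o; apply/eqP; rewrite -phi2.
  by case/and3P: partS => _ _ /negP[]; rewrite -i0 (valP i).
have phi_val (d : pts Delta) : phi (val d) = (d, Delta1).
  rewrite [phi _]surjective_pairing phi_fst; congr (_, _).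
  by apply/eqP; rewrite -phi2 (valP d).
have sGX : G \subset X := sub_closure2 G.
have twistedG g : g \in G ->
  exists2 x, forall i, x i \in R & exists s, twisted phi g x s.
  move/(subsetP sGW); rewrite inE => /exists_inP[w].
  case/mulsgP=> _ _ /imsetP[x /ffun_onP Rx ->] /imsetP[s _ ->] -> /forallP gxs.
  by exists x => //; exists s => o; rewrite (eqP (gxs o)) permM !permE.
pose top := actperm (subaction (pts Sigma) 'P^*).
have topE g o : g \in 'N(Sigma | 'P^*) -> (phi (g o)).2 = top g (phi o).2.
  move=> nSg; apply/eqP; rewrite -phi2 val_actperm_sub //.
  by apply: imset_f.
(* Let [g] agree with [x] at [o] in [B], and [h] at both [o] and [o'] in [B]. The blocks [B g] and
   [B h] share [x o], so they coincide and contain [x o']. *)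
have nSX : X \subset 'N(Sigma | 'P^*).
  apply/subsetP=> x /closure2P Xx; rewrite !inE; apply/subsetP=> B SB.
  rewrite inE; pose i : pts Sigma := exist _ B SB.
  have [o /eqP] := phi2_onto i; rewrite -phi2 => Bo.
  have [g Gg [go _]] := Xx o o.
  suff ->: ('P^*)%act B x = ('P^*)%act B g by rewrite (actsP actsG).
  apply/eqP; rewrite eqEcard !card_setact leqnn andbT.
  apply/subsetP=> _ /imsetP[o' Bo' ->]; rewrite /= /aperm.
  have [h Gh [ho ho']] := Xx o o'.
  have SBg : ('P^*)%act B g \in Sigma by rewrite (actsP actsG).
  have SBh : ('P^*)%act B h \in Sigma by rewrite (actsP actsG).
  rewrite -(def_pblock trivS SBg (_ : x o \in _)); last first.
    by rewrite -go; apply: (imset_f (aperm^~ g)).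
  rewrite (def_pblock trivS SBh (_ : x o \in _)); last first.
    by rewrite -ho; apply: (imset_f (aperm^~ h)).
  by rewrite -ho'; apply: (imset_f (aperm^~ h)).
have sGN : G \subset 'N(Sigma | 'P^*) := subset_trans sGX nSX.
(* Agreement on a pair of points gives agreement on the pair of their blocks, so [top x] lies in the
   2-closure of [L], which is [L]. *)
have topX x : x \in X ->
    exists2 g, g \in G & forall o, (phi (x o)).2 = (phi (g o)).2.
  move=> Xx; have nSx := subsetP nSX x Xx.
  have: top x \in L.
    rewrite closedL; apply/closure2P=> i j.
    have [[o io] [o' jo]] := (phi2_onto i, phi2_onto j).
    have [g Gg [go go']] := closure2P _ _ Xx o o'.
    have nSg := subsetP sGN g Gg.
    exists (top g); last by rewrite -io -jo -!topE // go go'.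
    by apply/inducedP; exists g; split=> // u; apply: val_actperm_sub.
  case/inducedP=> g [Gg nSg gx]; exists g => // o.
  suff eq_gx : top x = top g by rewrite !topE ?eq_gx.
  by apply/permP=> u; apply: val_inj; rewrite gx val_actperm_sub.
have memY (Q : {group {perm Omega}}) (y : {perm pts Delta}) :
    reflect (exists2 g, g \in Q & forall d, phi (g (val d)) = (y d, Delta1))
            (y \in induced 'P Delta 'N_Q(Delta | 'P)).
  apply: (iffP (@inducedP _ _ _ _ _ _)) => [[g [/setIP[Qg _] _ yg]] | [g Qg gy]].
    by exists g => // d; rewrite -phi_val yg.
  have {gy}gy d : g (val d) = val (y d).
    by apply: (bij_inj phi_bij); rewrite gy phi_val.
  have nDg : g \in 'N(Delta | 'P).
    rewrite !inE; apply/subsetP=> d Dd; rewrite inE /= /aperm.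
    by rewrite (gy (exist _ d Dd)) (valP (y _)).
  by exists g; split=> [||d]; rewrite -?gy // inE Qg.
have sRY : R \subset Y by apply/inducedS/setSI.
have transG i : exists2 g, g \in G & exists2 x, forall j, x j \in R &
    exists2 s, twisted phi g x s & s Delta1 = i.
  have [[o1 o1D] [o oi]] := (phi2_onto Delta1, phi2_onto i).
  have [g Gg def_o] := atransP2 trG (in_setT o1) (in_setT o).
  have [x Rx [s gxs]] := twistedG g Gg.
  exists g => //; exists x => //; exists s => //.
  by rewrite -oi def_o /= /aperm gxs o1D.
pose Yg := induced_group 'P Delta 'N_(closure2_group G)(Delta | 'P)%G.
have defY : Y = Yg by [].
have nVX : X \subset 'N(vertical phi).
  apply/subsetP=> x /(subsetP nSX) nSx; rewrite inE.
  apply/subsetP=> _ /imsetP[v /verticalP Vv ->]; apply/verticalP=> o.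
  by rewrite -[o](permKV x) permJ !(topE x) // Vv.
(* The kernel of [X] on [Sigma], defined without [Y]; it equals [N] once its coordinates are known
   to lie in [Y]. *)
pose K := (vertical_group phi :&: closure2_group G)%G.
have sKV : K \subset vertical phi := subsetIl _ _.
have nKX : X \subset 'N(K) by rewrite normsI ?normG.
(* Conjugating by an element of [G] moves coordinate [i] back to [Delta1], at the cost of a
   conjugation by an element of [R], a subgroup of [Y]. *)
have fiberY i k : k \in K -> fiber phi i k \in Y.
  move=> Kk; have [g Gg [x Rx [s gxs <-]]] := transG i.
  have Kk' : k ^ g^-1 \in K.
    by rewrite memJ_norm // groupV (subsetP nKX) ?(subsetP sGX).
  have [Vk' Xk'] := setIP Kk'.
  have [_] := fiber_conj phi_bij Delta1 gxs Vk'; rewrite conjgKV => ->.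
  apply: (groupJ (G := Yg)); last exact: (subsetP sRY).
  apply/(memY (closure2_group G)); exists (k ^ g^-1) => // d.
  by rewrite (fiberE phi_bij) // phi_val.
have defN : N = K.
  apply/setP=> k; rewrite inE mem_transport_base // [k \in K]inE andbC -andbA.
  apply: andb_id2l => Vk; case Xk: (k \in X); rewrite ?andbF ?andbT //=.
  by apply/forallP=> i; apply: fiberY; rewrite inE Vk.
(* The intersection is normal in [G] and contained in [M], so it lies in the trivial core. *)
have tiKG : K :&: G = 1.
  apply/trivgP; rewrite -coreM; apply: gcore_max.
    apply/subsetP=> g /setIP[/setIP[/verticalP Vg _] Gg]; rewrite inE Gg !inE.
    by apply/subsetP=> d; rewrite inE !phi2 /= /aperm Vg.
  by rewrite normsI ?normG // (subset_trans sGX).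
have defX : K * G = X.
  apply/eqP; rewrite eqEsubset mul_subG ?subsetIr //=.
  apply/subsetP=> x Xx; have [g Gg xg] := topX x Xx.
  have Xg := subsetP sGX g Gg; have nSg := subsetP nSX g Xg.
  rewrite -[x](mulgKV g) mem_mulg //; apply/setIP.
  split; last by rewrite groupM ?groupV.
  apply/verticalP=> o; apply: (@perm_inj _ (top g)).
  by rewrite -!topE // permM permKV xg.
rewrite defN; split; first by rewrite sdprodE // (subset_trans sGX).
have ntK : K :!=: 1.
  by apply: contraNneq neqGX => K1; rewrite -defX K1 mul1g.
split=> //.
pose A := (fiber_morphism phi_bij Delta1 @* K)%G.
(* Each [y] in [Y] is induced by some [x] in [X]; since [x] normalises [K], [y] normalises the
   projection of [K] at [Delta1]. *)
have nsAY : A <| Y.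
  apply/andP; split.
    by apply/subsetP=> _ /morphimP[k _ Kk ->]; apply: fiberY.
  apply/subsetP=> y /(memY (closure2_group G))[x Xx xy]; rewrite inE.
  apply/subsetP=> _ /imsetP[_ /morphimP[k Vk Kk ->] ->] /=.
  have Kkx : k ^ x \in K by rewrite memJ_norm ?(subsetP nKX).
  suff <-: fiber phi Delta1 (k ^ x) = fiber phi Delta1 k ^ y.
    by rewrite (mem_morphim (fiber_morphism phi_bij Delta1)) ?(subsetP sKV).
  apply: (fiber_uniq phi_bij) => [|o oD]; first exact: (subsetP sKV).
  pose d := y^-1 (phi o).1.
  have ->: o = x (val d).
    apply: (bij_inj phi_bij); rewrite xy permKV.
    by rewrite [LHS]surjective_pairing oD.
  have kd : k (val d) = val (fiber phi Delta1 k d).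
    by apply: (bij_inj phi_bij); rewrite fiberE // !phi_val.
  by rewrite permJ kd !xy permJ.
have nAR : R \subset 'N(A) := subset_trans sRY (normal_norm nsAY).
have nKG : G \subset 'N(K) := subset_trans sGX nKX.
have memM g x s : g \in G -> twisted phi g x s ->
    (g \in M) = (s Delta1 == Delta1).
  move=> Gg gxs; rewrite inE Gg !inE.
  apply/subsetP/eqP=> [sD | sD d].
    have [o oD] := phi2_onto Delta1.
    have:= sD o; rewrite inE !phi2 /= /aperm gxs oD /= eqxx.
    by move/(_ isT)/eqP.
  by rewrite inE !phi2 /= /aperm gxs /= => /eqP->; apply/eqP.
have ntA : A :!=: 1.
  by apply: contraNneq ntK => /(normalised_eq1 sKV nKG transG nAR (erefl _))->.
exists A; split.
- by split=> //; apply: (subdirect_normalised sKV nKG transG nAR).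
- move=> maxM.
  have [eq_ker | neq_ker] :=
    ker_fiber_dichotomy phi_bij sKV nKG twistedG transG maxM memM.
    by left; apply: (full_diagonal_ker_fiber sKV nKG transG nAR).
  right; split=> [i j neq_ij diag_ij|].
    have/eqP[] := neq_ker i j neq_ij.
    exact: (ker_fiber_full_diagonal2 phi_bij sKV diag_ij).
  have ntY : Yg :!=: 1.
    by apply: contraNneq ntA => Y1; apply/eqP/trivgP; rewrite -Y1 (normal_sub nsAY).
  rewrite defY; have [T1 | ntT] := eqVneq (subnormal_core Yg) 1.
    (* A trivial [S(Y)] gives a trivial base group, which [N] contains. *)
    left; apply/subsetP=> k; rewrite T1 mem_transport_base // => /andP[Vk /forallP k1].
    rewrite (fiber_eq1 phi_bij Vk) ?group1 // => i.
    by apply/set1P; apply: k1.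
  have simT := subnormal_core_simple ntY ntT.
  have [cTT | not_cTT] := boolP (abelian (subnormal_core Yg)).
    (* Being simple and abelian, [S(Y)] has prime order. *)
    right; exists (subnormal_core_group Yg).
    split; first exact: minimal_normal_subnormal_core.
      by move=> H; apply: minimal_normal_eq_subnormal_core.
    have p_pr := simple_sol_prime (abelian_sol cTT) simT.
    exists #|subnormal_core Yg| => //.
    by rewrite isog_cyclic_card ?prime_cyclic //= ?card_Zp ?cardG_gt0.
  left; apply: (transport_base_sub_perfect sKV nKG transG nAR (erefl _)) => //.
  (* The derived subgroup is normal in the simple group [S(Y)] and nontrivial, so [S(Y)] is
     perfect. *)
  - have/simpleP[_ /(_ _ (der_normal 1 _))[|//]] := simT.
    by move/eqP; rewrite (sameP eqP commG1P) => cTT; case/negP: not_cTT.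
  - by apply: subnormal_core_min; rewrite ?normal_subnormal.
  move=> H nsHA ntH; apply: subnormal_core_min => //.
  exact: subnormal_trans (normal_subnormal nsHA) (normal_subnormal nsAY).
move=> p maxM not_nsMG p_pr oR diagK.
pose Rg := induced_group 'P Delta 'N_G(Delta | 'P)%G.
have oRg : #|Rg| = p := oR.
have cRR : abelian Rg by rewrite cyclic_abelian ?prime_cyclic // oRg.
have trR : [transitive Rg, on [set: pts Delta] | 'P].
  have [o /eqP] := phi2_onto Delta1; rewrite -phi2 => Do.
  pose d0 : pts Delta := exist _ o Do.
  apply/imsetP; exists d0; rewrite ?inE //; apply/setP=> d; rewrite inE; apply/esym.
  have [g Gg gd] := atransP2 trG (in_setT (val d0)) (in_setT (val d)).
  have [x Rx [s gxs]] := twistedG g Gg.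
  apply/orbitP; exists (x Delta1); first exact: Rx.
  have:= phi_val d; rewrite gd /= /aperm gxs.
  by have -> := phi_val d0; case.
(* On each pair of points of [Delta], [y] agrees with the base part at [Delta1] of an element of
   [G], so it lies in the 2-closure of [R], which is [R]. *)
have YR : Y = R.
  apply/eqP; rewrite eqEsubset sRY andbT.
  have closedR : closure2 Rg = R := closure2_abelian_transitive cRR trR.
  rewrite -closedR.
  apply/subsetP=> y /(memY (closure2_group G))[x Xx xy]; apply/closure2P=> a b.
  have [g Gg [ga gb]] := closure2P _ _ Xx (val a) (val b).
  have [z Rz [s gxs]] := twistedG g Gg.
  exists (z Delta1); first exact: Rz.
  have:= gxs (val a); have:= gxs (val b).
  by rewrite ga gb !xy !phi_val /= => -[-> _] [-> _].
(* [A] is a nontrivial subgroup of [R], which has prime order. *)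
have AR : A = Rg.
  apply/group_inj/eqP; rewrite eqEsubset.
  have sAR : A \subset R by rewrite -YR normal_sub.
  rewrite sAR; apply: contraR ntA => notsRA.
  by rewrite -(setIidPl sAR) setIC (@prime_TIg _ Rg) // oRg.
split=> //.
- rewrite -[R]/(gval Rg) -AR.
  apply: (straight_diagonal_normalised sKV nKG twistedG transG nAR (erefl _)
            maxM not_nsMG memM _ _ diagK); by rewrite -[gval _]/(gval A) AR.
(* The base group is elementary abelian, so comparing orders with the row space gives the
   isomorphism. *)
have abR : p.-abelem Rg by rewrite -oRg prime_abelem ?oRg.
rewrite (isog_abelem_card _ (abelem_transport_base phi_bij p_pr abR)).
rewrite mx_Fp_abelem // cardsT card_mx card_Fp // mul1n.
rewrite (card_transport_base phi_bij Rg) oRg card_sig andTb; apply/eqP.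
by congr (_ ^ _)%N; apply: eq_card => i; rewrite inE.
Qed.
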